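(* There exists no lifting of the diagram $\vec{D}$, with respect to the functor $\mathrm{V}$, by any commutative diagram of rings and ring homomorphisms in which the lifts of $\boldsymbol{B}_0$, $\boldsymbol{B}_1$ and $\boldsymbol{B}_2$ are all V-semiprimitive. That is, there is no $\{0,1\}^3$-indexed commutative diagram $\vec{R}$ of rings and ring homomorphisms such that $\mathrm{V}\vec{R}$ is naturally isomorphic to $\vec{D}$ and the rings of $\vec{R}$ at the positions of $\boldsymbol{B}_0$, $\boldsymbol{B}_1$, $\boldsymbol{B}_2$ are all V-semiprimitive.
   Context: Rings are associative, not necessarily unital; ring homomorphisms need not preserve units. $\mathbb{Z}^+=\{0,1,2,\dots\}$. The diagram $\vec{D}$: it is the commutative diagram of commutative monoids indexed by the cube $\{0,1\}^3$ with vertices $\boldsymbol{A}=\boldsymbol{B}=\mathbb{Z}^+$ (bottom and top) and $\boldsymbol{A}_j=\boldsymbol{B}_j=\mathbb{Z}^+\times\mathbb{Z}^+$ for $j\in\{0,1,2\}$. Let $\boldsymbol{e}(x)=(x,x)$, $\boldsymbol{s}(x,y)=(y,x)$, $\boldsymbol{h}(x,y)=x+y$. The arrows are: $\boldsymbol{e}\colon\boldsymbol{A}\to\boldsymbol{A}_j$ for each $j$; the identity maps $\boldsymbol{A}_0\to\boldsymbol{B}_2$, $\boldsymbol{A}_0\to\boldsymbol{B}_1$, $\boldsymbol{A}_1\to\boldsymbol{B}_0$, $\boldsymbol{A}_2\to\boldsymbol{B}_1$, $\boldsymbol{A}_2\to\boldsymbol{B}_0$; the map $\boldsymbol{s}\colon\boldsymbol{A}_1\to\boldsymbol{B}_2$;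 and $\boldsymbol{h}\colon\boldsymbol{B}_j\to\boldsymbol{B}$ for each $j$. For a ring $R$, $\mathrm{V}(R)$ is the conical commutative monoid of equivalence classes $[a]_R$ of elements $a$ of the set $\mathrm{I}_\infty(R)$ of idempotents of $\mathrm{M}_\infty(R)=\bigcup_n\mathrm{M}_n(R)$ (embedding $\mathrm{M}_n(R)$ into $\mathrm{M}_{n+1}(R)$ by adding a zero row and column), where $a\sim b$ if $a=xy$, $b=yx$ for some $x,y\in\mathrm{M}_\infty(R)$, with addition determined by $[a]_R+[b]_R=[a+b]_R$ whenever $ab=ba=0$. A ring homomorphism $f\colon R\to S$ induces $\mathrm{V}(f)\colon[a]_R\mapsto[f(a)]_S$. In a conical commutative monoid, $x\leq y$ means $y=x+z$ for some $z$, and $\alpha\perp\beta$ means that for all positive integers $n$ and all $\gamma$, $\gamma\leq n\alpha$ and $\gamma\leq n\beta$ imply $\gamma=0$. A ring $R$ is V-semiprimitive if for all $a,b\in \mathrm{I}_\infty(R)$, $[a]_R\perp[b]_R$ in $\mathrm{V}(R)$ implies $ab=0$. *)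

(* Defs.v *)
From HB Require Import structures.
From mathcomp Require Import all_boot all_order all_algebra.
From mathcomp Require Import boolp classical_sets functions cardinality fsbigop.

Set Implicit Arguments.
Unset Strict Implicit.
Unset Printing Implicit Defensive.

Import Order.TTheory GRing.Theory.

Local Open Scope ring_scope.
Local Open Scope quotient_scope.

Reserved Notation "x ** y" (at level 40, left associativity).

(* Associative rings, with no unit required. *)
HB.mixin Record Zmodule_isRng R of GRing.Zmodule R := {
  rmul : R -> R -> R;
  rmulA : associative rmul;
  rmulDl : left_distributive rmul +%R;
  rmulDr : right_distributive rmul +%R
}.

#[short(type="rngType")]
HB.structure Definition Rng := {R of Zmodule_isRng R & GRing.Zmodule R}.

Notation "x ** y" := (rmul x y) : ring_scope.

HB.mixin Record isRngMorphism (R S : rngType) (f : R -> S) := {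
  rng_morphM_subproof : {morph f : x y / x ** y}
}.

HB.structure Definition RngMorphism (R S : rngType) :=
  {f of @isRngMorphism R S f & @GRing.isNmodMorphism R S f}.

Notation "{ 'rngmorphism' R -> S }" := (RngMorphism.type R S)
  (at level 0, R at level 98, S at level 99,
   format "{ 'rngmorphism'  R  ->  S }") : type_scope.

Section RngTheory.
Variables R S : rngType.
Implicit Types x y z : R.

Lemma rng_morphM (f : {rngmorphism R -> S}) : {morph f : x y / x ** y}.
Proof. exact: rng_morphM_subproof. Qed.

Lemma rmul0r x : 0 ** x = 0.
Proof. by apply: (addrI (0 ** x)); rewrite -rmulDl !addr0. Qed.

Lemma rmulr0 x : x ** 0 = 0.
Proof. by apply: (addrI (x ** 0)); rewrite -rmulDr !addr0. Qed.

Lemma rmul_suml (I : Type) (r : seq I) (P : pred I) (F : I -> R) x :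
  (\sum_(i <- r | P i) F i) ** x = \sum_(i <- r | P i) F i ** x.
Proof.
by elim/big_rec2: _ => [|i u v _ <-]; rewrite ?rmul0r ?rmulDl.
Qed.

Lemma rmul_sumr (I : Type) (r : seq I) (P : pred I) (F : I -> R) x :
  x ** (\sum_(i <- r | P i) F i) = \sum_(i <- r | P i) x ** F i.
Proof.
by elim/big_rec2: _ => [|i u v _ <-]; rewrite ?rmulr0 ?rmulDr.
Qed.

End RngTheory.

(* The union along the embeddings that add a zero row and a zero column is
   realized by the N x N matrices that vanish outside some n x n corner. *)
Definition finitary (R : zmodType) : {pred nat -> nat -> R} :=
  fun a => `[< exists n, forall i j, (n <= i)%N || (n <= j)%N -> a i j = 0 >].

Section FinitaryZmod.
Variable R : zmodType.

Lemma finitaryP (a : nat -> nat -> R) :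
  reflect (exists n, forall i j, (n <= i)%N || (n <= j)%N -> a i j = 0)
          (a \in @finitary R).
Proof. exact: asboolP. Qed.

Lemma finitary_zmod : GRing.zmod_closed (@finitary R).
Proof.
split; first by apply/finitaryP; exists 0%N.
move=> a b /finitaryP [n an] /finitaryP [m bm].
apply/finitaryP; exists (maxn n m) => i j.
rewrite !geq_max => h; rewrite -[LHS]/(a i j - b i j) an ?bm ?subr0 //.
  by case/orP: h => /andP[_ ->]; rewrite ?orbT.
by case/orP: h => /andP[-> _]; rewrite ?orbT.
Qed.
HB.instance Definition _ :=
  GRing.isZmodClosed.Build (nat -> nat -> R) (@finitary R) finitary_zmod.

Record Minf := FinitaryMx {
  mx_entry :> nat -> nat -> R;
  mx_finitary : mx_entry \in @finitary R
}.
HB.instance Definition _ := [isSub for mx_entry].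
HB.instance Definition _ := [Choice of Minf by <:].
HB.instance Definition _ := [SubChoice_isSubZmodule of Minf by <:].

Lemma MinfP (a b : Minf) : (forall i j, a i j = b i j) -> a = b.
Proof. by move=> ab; apply: val_inj; apply/funext => i; apply/funext => j; exact: ab. Qed.

Lemma MinfD (a b : Minf) i j : (a + b) i j = a i j + b i j.
Proof. by []. Qed.

Lemma Minf0 i j : (0 : Minf) i j = 0.
Proof. by []. Qed.

Lemma Minf_bound (a : Minf) :
  exists n, forall i j, (n <= i)%N || (n <= j)%N -> a i j = 0.
Proof. by case: a => a /= /finitaryP. Qed.

End FinitaryZmod.

Section MinfRng.
Variable R : rngType.
Implicit Types a b c : Minf R.

Definition Minf_mul_entry a b (i j : nat) : R :=
  \sum_(k \in [set: nat]) a i k ** b k j.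

Lemma Minf_mul_entryE n a b i j :
    (forall k, (n <= k)%N -> a i k ** b k j = 0) ->
  Minf_mul_entry a b i j = \sum_(k < n) a i k ** b k j.
Proof.
move=> h; rewrite (fsbig_ord _ n (fun k => a i k ** b k j)).
apply/esym/fsbig_widen => //= k [_ /negP].
by rewrite -leqNgt => /h.
Qed.

Lemma Minf_mul_finitary a b : Minf_mul_entry a b \in @finitary R.
Proof.
have [n an] := Minf_bound a; have [m bm] := Minf_bound b.
apply/finitaryP; exists (maxn n m) => i j h; apply: fsbig1 => k _.
case/orP: h; rewrite geq_max => /andP[ni mi].
  by rewrite an ?ni // rmul0r.
by rewrite bm ?mi ?orbT // rmulr0.
Qed.

Definition Minf_mul a b : Minf R := FinitaryMx (Minf_mul_finitary a b).

Lemma Minf_mulE n a b i j :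
    (forall k, (n <= k)%N -> a i k ** b k j = 0) ->
  Minf_mul a b i j = \sum_(k < n) a i k ** b k j.
Proof. exact: Minf_mul_entryE. Qed.

Lemma Minf_mul_bound a b c :
  exists n, [/\ forall i k, (n <= k)%N -> a i k = 0,
                forall i k, (n <= k)%N -> b i k = 0 /\ b k i = 0
              & forall j k, (n <= k)%N -> c k j = 0].
Proof.
have [n an] := Minf_bound a; have [m bm] := Minf_bound b.
have [p cp] := Minf_bound c.
exists (maxn n (maxn m p)); split=> i k; rewrite !geq_max => /and3P[nk mk pk].
- by rewrite an ?nk ?orbT.
- by rewrite !bm ?mk ?orbT.
- by rewrite cp ?pk.
Qed.

Lemma Minf_mulA : associative Minf_mul.
Proof.
move=> a b c; have [n [an bn cn]] := Minf_mul_bound a b c.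
apply: MinfP => i j /=.
rewrite [LHS](@Minf_mul_entryE n) => [|k nk]; last by rewrite an // rmul0r.
rewrite [RHS](@Minf_mul_entryE n) => [|k nk]; last by rewrite cn // rmulr0.
have abE k : Minf_mul a b i k = \sum_(l < n) a i l ** b l k.
  by apply: Minf_mul_entryE => l nl; rewrite an // rmul0r.
have bcE k : Minf_mul b c k j = \sum_(l < n) b k l ** c l j.
  by apply: Minf_mul_entryE => l nl; rewrite cn // rmulr0.
under eq_bigr do rewrite bcE rmul_sumr.
rewrite exchange_big; apply: eq_bigr => k _ /=.
by rewrite -[Minf_mul_entry _ _ _ _]/(Minf_mul a b i k) abE rmul_suml; apply: eq_bigr => l _; rewrite rmulA.
Qed.

Lemma Minf_mulDl : left_distributive Minf_mul +%R.
Proof.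
move=> a b c; have [n [an bn cn]] := Minf_mul_bound a b c.
apply: MinfP => i j; rewrite MinfD !(@Minf_mulE n).
- by rewrite -big_split; apply: eq_bigr => k _; rewrite MinfD rmulDl.
- by move=> k nk; rewrite cn // rmulr0.
- by move=> k nk; rewrite cn // rmulr0.
- by move=> k nk; rewrite cn // rmulr0.
Qed.

Lemma Minf_mulDr : right_distributive Minf_mul +%R.
Proof.
move=> a b c; have [n [an bn cn]] := Minf_mul_bound a b c.
apply: MinfP => i j; rewrite MinfD !(@Minf_mulE n).
- by rewrite -big_split; apply: eq_bigr => k _; rewrite MinfD rmulDr.
- by move=> k nk; rewrite an // rmul0r.
- by move=> k nk; rewrite an // rmul0r.
- by move=> k nk; rewrite an // rmul0r.
Qed.

HB.instance Definition _ :=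
  Zmodule_isRng.Build (Minf R) Minf_mulA Minf_mulDl Minf_mulDr.

Lemma MinfME a b i j : (a ** b) i j = \sum_(k \in [set: nat]) a i k ** b k j.
Proof. by []. Qed.

Lemma MinfM n a b i j :
    (forall k, (n <= k)%N -> a i k ** b k j = 0) ->
  (a ** b) i j = \sum_(k < n) a i k ** b k j.
Proof. exact: Minf_mul_entryE. Qed.

End MinfRng.

Section MinfMap.
Variables (R S : rngType) (f : {rngmorphism R -> S}).

Lemma Minf_map_finitary (a : Minf R) :
  (fun i j => f (a i j)) \in @finitary S.
Proof.
have [n an] := Minf_bound a.
by apply/finitaryP; exists n => i j h; rewrite an // raddf0.
Qed.

Definition Minf_map (a : Minf R) : Minf S := FinitaryMx (Minf_map_finitary a).

Lemma Minf_map_nmod : GRing.nmod_morphism Minf_map.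
Proof.
split; first by apply: MinfP => i j; exact: raddf0.
by move=> a b; apply: MinfP => i j; exact: raddfD.
Qed.
HB.instance Definition _ :=
  GRing.isNmodMorphism.Build (Minf R) (Minf S) Minf_map Minf_map_nmod.

Lemma Minf_mapM : {morph Minf_map : x y / x ** y}.
Proof.
move=> a b; have [n [an _ _]] := Minf_mul_bound a a a.
apply: MinfP => i j.
rewrite [RHS](@MinfM _ n) => [|k nk]; last by rewrite /= an // raddf0 rmul0r.
rewrite -[LHS]/(f ((a ** b) i j)) (@MinfM _ n) => [|k nk]; last first.
  by rewrite an // rmul0r.
by rewrite raddf_sum; apply: eq_bigr => k _; exact: rng_morphM.
Qed.
HB.instance Definition _ :=
  isRngMorphism.Build (Minf R) (Minf S) Minf_map Minf_mapM.

End MinfMap.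

Record Iinf (R : rngType) := IdemMx {
  idem_mx :> Minf R;
  idem_mxP : idem_mx ** idem_mx == idem_mx
}.
HB.instance Definition _ (R : rngType) := [isSub for @idem_mx R].
HB.instance Definition _ (R : rngType) := [Choice of Iinf R by <:].

Section Equivalence.
Variable R : rngType.
Implicit Types a b c : Iinf R.

Lemma Iinf_idem a : (a : Minf R) ** a = a.
Proof. exact/eqP/idem_mxP. Qed.

Definition idem_equiv a b : bool :=
  `[< exists x y : Minf R, a = x ** y :> Minf R /\ b = y ** x :> Minf R >].

Lemma idem_equivP a b : reflect
  (exists x y : Minf R, a = x ** y :> Minf R /\ b = y ** x :> Minf R) (idem_equiv a b).
Proof. exact: asboolP. Qed.

Lemma idem_equiv_refl : reflexive idem_equiv.
Proof. by move=> a; apply/idem_equivP; exists a, a; rewrite Iinf_idem. Qed.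

Lemma idem_equiv_sym : symmetric idem_equiv.
Proof.
by move=> a b; apply/idem_equivP/idem_equivP => -[x [y [? ?]]]; exists y, x.
Qed.

Lemma idem_equiv_trans : transitive idem_equiv.
Proof.
move=> b a c /idem_equivP[x [y [axy byx]]] /idem_equivP[z [w [bzw cwz]]].
apply/idem_equivP; exists (x ** z), (w ** y); split.
  by rewrite rmulA -(rmulA x) -bzw byx !rmulA -axy -rmulA -axy Iinf_idem.
by rewrite rmulA -(rmulA w) -byx bzw !rmulA -cwz -rmulA -cwz Iinf_idem.
Qed.

Canonical idem_equiv_rel :=
  EquivRel idem_equiv idem_equiv_refl idem_equiv_sym idem_equiv_trans.

Definition V := {eq_quot idem_equiv_rel}.
HB.instance Definition _ := Choice.on V.
HB.instance Definition _ := EqQuotient.on V.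

Definition Vclass a : V := \pi_V a.

Lemma VclassP a b : reflect
  (exists x y : Minf R, a = x ** y :> Minf R /\ b = y ** x :> Minf R)
  (Vclass a == Vclass b).
Proof. by rewrite piE; exact: idem_equivP. Qed.

Lemma Vclass_eq a b (x y : Minf R) :
  a = x ** y :> Minf R -> b = y ** x :> Minf R -> Vclass a = Vclass b.
Proof. by move=> ? ?; apply/eqP/VclassP; exists x, y. Qed.

Lemma Vclass_ind (P : V -> Prop) : (forall a, P (Vclass a)) -> forall u, P u.
Proof. by move=> h u; rewrite -[u]reprK; exact: h. Qed.

Lemma Vclass_repr a : exists x y : Minf R,
  repr (Vclass a) = x ** y :> Minf R /\ a = y ** x :> Minf R.
Proof. by apply/VclassP; rewrite {1}/Vclass reprK. Qed.

End Equivalence.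

(* The sum of two classes is computed from the orthogonal representatives of
   them that occupy the even-indexed, resp. odd-indexed, rows and columns.
   [VclassD] below shows that this is the addition determined by
   [a] + [b] = [a + b] whenever ab = ba = 0. *)
Section Spread.
Variable R : rngType.
Implicit Types (s t : bool) (a b c : Minf R).

Lemma row_spread_subproof s a :
  (fun i j => if odd i == s then a i./2 j else 0) \in @finitary R.
Proof.
have [n an] := Minf_bound a; apply/finitaryP; exists n.*2 => i j h.
case: ifP => // _; apply: an; case/orP: h => h; apply/orP.
  by left; rewrite geq_half_double.
by right; rewrite (leq_trans _ h) // -addnn leq_addr.
Qed.
Definition row_spread s a : Minf R := FinitaryMx (row_spread_subproof s a).

Lemma col_spread_subproof s a :
  (fun i j => if odd j == s then a i j./2 else 0) \in @finitary R.
Proof.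
have [n an] := Minf_bound a; apply/finitaryP; exists n.*2 => i j h.
case: ifP => // _; apply: an; case/orP: h => h; apply/orP.
  by left; rewrite (leq_trans _ h) // -addnn leq_addr.
by right; rewrite geq_half_double.
Qed.
Definition col_spread s a : Minf R := FinitaryMx (col_spread_subproof s a).

Lemma row_spreadM s a b : row_spread s a ** b = row_spread s (a ** b).
Proof.
apply: MinfP => i j; rewrite /= /Minf_mul_entry /=; case: ifP => // _.
by apply: fsbig1 => k _; rewrite rmul0r.
Qed.

Lemma col_spreadM s a b : a ** col_spread s b = col_spread s (a ** b).
Proof.
apply: MinfP => i j; rewrite /= /Minf_mul_entry /=; case: ifP => // _.
by apply: fsbig1 => k _; rewrite rmulr0.
Qed.

Lemma row_col_spread s t a :
  row_spread s (col_spread t a) = col_spread t (row_spread s a).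
Proof. by apply: MinfP => i j /=; do 2 case: ifP. Qed.

Lemma spread_mul s t a b :
  col_spread s a ** row_spread t b = if s == t then a ** b else 0.
Proof.
have [n [an _ _]] := Minf_mul_bound a a a.
apply: MinfP => i j; rewrite (@MinfM _ n.*2) /=; last first.
  move=> k nk; case: ifP => _; last by rewrite rmul0r.
  by rewrite an ?rmul0r // -(half_double n) half_leq.
have -> : \sum_(k < n.*2) (if odd k == s then a i k./2 else 0) **
            (if odd k == t then b k./2 j else 0) =
          \sum_(k < n) (if s == t then a i k ** b k j else 0).
  rewrite -(big_mkord xpredT (fun k => (if odd k == s then a i k./2 else 0) **
            (if odd k == t then b k./2 j else 0))).
  rewrite -(big_mkord xpredT (fun k => if s == t then a i k ** b k j else 0)).
  elim: n {an} => [|n IHn]; first by rewrite !big_geq.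
  rewrite doubleS !big_nat_recr //= IHn -addrA; congr (_ + _).
  rewrite odd_double /= uphalf_double doubleK.
  by case: s t {IHn} => [] [] /=; rewrite ?(rmul0r, rmulr0, addr0, add0r).
case: ifP => _; last by rewrite big1.
by rewrite (@MinfM _ n) // => k nk; rewrite an // rmul0r.
Qed.

Lemma row_spreadD s a b : row_spread s (a + b) = row_spread s a + row_spread s b.
Proof.
by apply: MinfP => i j; rewrite MinfD /=; case: ifP; rewrite ?addr0.
Qed.

Lemma col_spreadD s a b : col_spread s (a + b) = col_spread s a + col_spread s b.
Proof.
by apply: MinfP => i j; rewrite MinfD /=; case: ifP; rewrite ?addr0.
Qed.

Definition spread s a : Minf R := row_spread s (col_spread s a).

Definition dsum a b : Minf R := spread false a + spread true b.

Lemma spreadM s t a b :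
  spread s a ** spread t b = if s == t then spread s (a ** b) else 0.
Proof.
rewrite /spread row_spreadM spread_mul; case: (eqVneq s t) => [->|_].
  by rewrite col_spreadM.
by apply: MinfP => i j /=; case: ifP.
Qed.

Lemma spread0 s : spread s 0 = 0.
Proof. by apply: MinfP => i j /=; do 2 case: ifP => //. Qed.

Lemma dsumM a b a' b' : dsum a b ** dsum a' b' = dsum (a ** a') (b ** b').
Proof. by rewrite /dsum rmulDl !rmulDr !spreadM /= addr0 add0r. Qed.

End Spread.

Section VMonoid.
Variable R : rngType.
Implicit Types (a b c : Iinf R) (u v w : V R).

Lemma dsum_idem a b : dsum a b ** dsum a b == dsum a b.
Proof. by rewrite dsumM !Iinf_idem. Qed.
Definition Idsum a b : Iinf R := IdemMx (dsum_idem a b).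

Lemma Iinf0_subproof : (0 : Minf R) ** 0 == 0.
Proof. by rewrite rmul0r. Qed.
Definition Iinf0 : Iinf R := IdemMx Iinf0_subproof.

Definition V_zero : V R := Vclass Iinf0.
Definition V_add u v : V R := Vclass (Idsum (repr u) (repr v)).

Lemma V_add_class a b : V_add (Vclass a) (Vclass b) = Vclass (Idsum a b).
Proof.
have [x [y [axy ayx]]] := Vclass_repr a.
have [z [w [bzw bwz]]] := Vclass_repr b.
apply: (@Vclass_eq _ _ _ (dsum x z) (dsum y w)); rewrite /= dsumM.
  by rewrite axy bzw.
by rewrite ayx bwz.
Qed.

Lemma V_add_orthogonal a b c : (a : Minf R) ** b = 0 -> (b : Minf R) ** a = 0 ->
  c = (a : Minf R) + b :> Minf R -> V_add (Vclass a) (Vclass b) = Vclass c.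
Proof.
move=> ab0 ba0 cE; rewrite V_add_class; apply/esym.
apply: (@Vclass_eq _ _ _ (col_spread false a + col_spread true b)
                        (row_spread false a + row_spread true b)).
  by rewrite rmulDl !rmulDr !spread_mul /= !Iinf_idem addr0 add0r cE.
rewrite rmulDl !rmulDr !row_spreadM !col_spreadM !Iinf_idem ab0 ba0.
have z s t : row_spread s (col_spread t (0 : Minf R)) = 0.
  by apply: MinfP => i j /=; do ?case: ifP.
by rewrite !z addr0 add0r.
Qed.

Lemma spread_idem s a : spread s a ** spread s a == spread s a.
Proof. by rewrite spreadM eqxx Iinf_idem. Qed.
Definition Ispread s a : Iinf R := IdemMx (spread_idem s a).

Lemma Vclass_spread s a : Vclass (Ispread s a) = Vclass a.
Proof.
apply: (@Vclass_eq _ _ _ (row_spread s a) (col_spread s a)); rewrite /=.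
  by rewrite row_spreadM col_spreadM Iinf_idem.
by rewrite spread_mul eqxx Iinf_idem.
Qed.

Lemma V_addC : commutative V_add.
Proof.
elim/Vclass_ind => a; elim/Vclass_ind => b.
rewrite [LHS]V_add_class -(Vclass_spread true b) -(Vclass_spread false a).
apply/esym/V_add_orthogonal; rewrite /= ?spreadM //.
by rewrite /dsum addrC.
Qed.

Lemma V_addA : associative V_add.
Proof.
elim/Vclass_ind => a; elim/Vclass_ind => b; elim/Vclass_ind => c.
pose a' := Ispread false a.
pose b' := Ispread true (Ispread false b); pose c' := Ispread true (Ispread true c).
have <- : Vclass a' = Vclass a by rewrite !Vclass_spread.
have <- : Vclass b' = Vclass b by rewrite !Vclass_spread.
have <- : Vclass c' = Vclass c by rewrite !Vclass_spread.
have sum_idem (x y : Iinf R) : (x : Minf R) ** y = 0 -> (y : Minf R) ** x = 0 ->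
    ((x : Minf R) + y) ** ((x : Minf R) + y) == (x : Minf R) + y.
  by move=> xy yx; rewrite rmulDl !rmulDr !Iinf_idem xy yx addr0 add0r.
have ab : (a' : Minf R) ** b' = 0 by rewrite /= spreadM.
have ba : (b' : Minf R) ** a' = 0 by rewrite /= spreadM.
have ac : (a' : Minf R) ** c' = 0 by rewrite /= spreadM.
have ca : (c' : Minf R) ** a' = 0 by rewrite /= spreadM.
have bc : (b' : Minf R) ** c' = 0 by rewrite /= spreadM /= spreadM /= spread0.
have cb : (c' : Minf R) ** b' = 0 by rewrite /= spreadM /= spreadM /= spread0.
rewrite (@V_add_orthogonal a' b' (IdemMx (sum_idem _ _ ab ba))) //.
rewrite (@V_add_orthogonal b' c' (IdemMx (sum_idem _ _ bc cb))) //.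
set bc' := IdemMx _; set ab' := IdemMx _.
have abc0 : (a' : Minf R) ** bc' = 0 by rewrite [bc' : Minf R]/= rmulDr ab ac addr0.
have bca0 : (bc' : Minf R) ** a' = 0 by rewrite [bc' : Minf R]/= rmulDl ba ca addr0.
rewrite (@V_add_orthogonal a' bc' (IdemMx (sum_idem _ _ abc0 bca0))) //.
apply/esym/V_add_orthogonal => /=.
- by rewrite rmulDl ac bc addr0.
- by rewrite rmulDr ca cb addr0.
- by rewrite addrA.
Qed.

Lemma V_add0 : left_id V_zero V_add.
Proof.
elim/Vclass_ind => a; apply: V_add_orthogonal; rewrite /= ?rmul0r ?rmulr0 //.
by rewrite add0r.
Qed.

HB.instance Definition _ := GRing.isNmodule.Build (V R) V_addA V_addC V_add0.

Lemma VclassD a b c : (a : Minf R) ** b = 0 -> (b : Minf R) ** a = 0 ->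
  c = (a : Minf R) + b :> Minf R -> Vclass a + Vclass b = Vclass c.
Proof. exact: V_add_orthogonal. Qed.

Lemma VclassD_dsum a b : Vclass a + Vclass b = Vclass (Idsum a b).
Proof. exact: V_add_class. Qed.

Lemma Vclass0 : Vclass Iinf0 = 0.
Proof. by []. Qed.

Lemma V_conical u v : u + v = 0 -> u = 0 /\ v = 0.
Proof.
have eq0 a : Vclass a = 0 -> (a : Minf R) = 0.
  move=> /eqP/VclassP[x [y [axy yx0]]].
  by rewrite -Iinf_idem axy rmulA -(rmulA x) -yx0 rmulr0 rmul0r.
elim/Vclass_ind: u => a; elim/Vclass_ind: v => b; rewrite VclassD_dsum => /eq0 /= ab0.
split; rewrite -Vclass0; congr Vclass; apply: val_inj; apply: MinfP => i j /=.
- have /(congr1 (fun m : Minf R => m i.*2 j.*2)) := ab0.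
  by rewrite /dsum MinfD /= !odd_double /= !doubleK addr0.
- have /(congr1 (fun m : Minf R => m i.*2.+1 j.*2.+1)) := ab0.
  by rewrite /dsum MinfD /= !odd_double /= !uphalf_double add0r.
Qed.

End VMonoid.

Section VFunctor.
Variables (R S : rngType) (f : {rngmorphism R -> S}).

Lemma Iinf_map_subproof (a : Iinf R) :
  Minf_map f a ** Minf_map f a == Minf_map f a.
Proof. by rewrite -rng_morphM Iinf_idem. Qed.
Definition Iinf_map (a : Iinf R) : Iinf S := IdemMx (Iinf_map_subproof a).

Definition V_map (u : V R) : V S := Vclass (Iinf_map (repr u)).

Lemma V_map_class a : V_map (Vclass a) = Vclass (Iinf_map a).
Proof.
have [x [y [axy ayx]]] := Vclass_repr a.
by apply: (@Vclass_eq _ _ _ (Minf_map f x) (Minf_map f y));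
  rewrite -rng_morphM /= ?axy ?ayx.
Qed.

Lemma V_map_nmod : GRing.nmod_morphism V_map.
Proof.
split.
  rewrite -Vclass0 V_map_class -Vclass0; congr Vclass; apply: val_inj => /=.
  exact: raddf0.
elim/Vclass_ind => a; elim/Vclass_ind => b.
rewrite VclassD_dsum !V_map_class VclassD_dsum; congr Vclass; apply: val_inj => /=.
rewrite raddfD; congr (_ + _); apply: MinfP => i j /=;
  by do ?[case: ifP => _]; rewrite ?raddf0.
Qed.
HB.instance Definition _ := GRing.isNmodMorphism.Build (V R) (V S) V_map V_map_nmod.

End VFunctor.

Definition mon_le (M : nmodType) (x y : M) : Prop := exists z, y = x + z.

Definition mon_perp (M : nmodType) (x y : M) : Prop :=
  forall n (z : M), (0 < n)%N -> mon_le z (x *+ n) -> mon_le z (y *+ n) -> z = 0.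

Definition V_semiprimitive (R : rngType) : Prop :=
  forall a b : Iinf R, mon_perp (Vclass a) (Vclass b) -> (a : Minf R) ** b = 0.

Record rng_diagram (d : Order.disp_t) (I : porderType d) := RngDiagram {
  rng_ob :> I -> rngType;
  rng_mor : forall i j, (i <= j)%O -> {rngmorphism rng_ob i -> rng_ob j};
  rng_mor_id : forall i (ii : (i <= i)%O), rng_mor ii =1 id;
  rng_mor_comp : forall i j k (ij : (i <= j)%O) (jk : (j <= k)%O) (ik : (i <= k)%O),
    rng_mor ik =1 rng_mor jk \o rng_mor ij
}.

Record mon_diagram (d : Order.disp_t) (I : porderType d) := MonDiagram {
  mon_ob :> I -> nmodType;
  mon_mor : forall i j, (i <= j)%O -> {additive mon_ob i -> mon_ob j};
  mon_mor_id : forall i (ii : (i <= i)%O), mon_mor ii =1 id;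
  mon_mor_comp : forall i j k (ij : (i <= j)%O) (jk : (j <= k)%O) (ik : (i <= k)%O),
    mon_mor ik =1 mon_mor jk \o mon_mor ij
}.

Definition mon_diagram_iso (d : Order.disp_t) (I : porderType d)
    (X Y : mon_diagram I) : Prop :=
  exists phi : forall i, {additive X i -> Y i},
    (forall i, bijective (phi i)) /\
    (forall i j (ij : (i <= j)%O),
      phi j \o mon_mor X ij =1 mon_mor Y ij \o phi i).

Section VDiagram.
Variables (d : Order.disp_t) (I : porderType d) (R : rng_diagram I).

Lemma V_mor_id i (ii : (i <= i)%O) : V_map (rng_mor R ii) =1 id.
Proof.
elim/Vclass_ind => a; rewrite V_map_class; congr Vclass; apply: val_inj.
by apply: MinfP => p q /=; exact: rng_mor_id.
Qed.

Lemma V_mor_comp i j k (ij : (i <= j)%O) (jk : (j <= k)%O) (ik : (i <= k)%O) :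
  V_map (rng_mor R ik) =1 V_map (rng_mor R jk) \o V_map (rng_mor R ij).
Proof.
elim/Vclass_ind => a; rewrite /= !V_map_class; congr Vclass; apply: val_inj.
by apply: MinfP => p q /=; exact: rng_mor_comp.
Qed.

Definition V_diagram : mon_diagram I :=
  @MonDiagram d I (fun i => V (R i)) (fun i j ij => V_map (rng_mor R ij))
    V_mor_id V_mor_comp.

End VDiagram.

(* [*p] is the product with the componentwise order. *)
Definition cube := (bool *p bool *p bool)%type.

Definition vA : cube := (false, false, false).
Definition vA0 : cube := (true, false, false).
Definition vA1 : cube := (false, true, false).
Definition vA2 : cube := (false, false, true).
Definition vB0 : cube := (false, true, true).
Definition vB1 : cube := (true, false, true).
Definition vB2 : cube := (true, true, false).
Definition vB : cube := (true, true, true).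

Definition map_e (x : nat) : nat * nat := (x, x).
Definition map_s (x : nat * nat) : nat * nat := (x.2, x.1).
Definition map_h (x : nat * nat) : nat := (x.1 + x.2)%N.

Definition outer (v : cube) : bool := let: (x, y, z) := v in (x == y) && (y == z).

Definition outer_mon (o : bool) : nmodType :=
  if o then (nat : nmodType) else ((nat * nat)%type : nmodType).

Definition D_ob (v : cube) : nmodType := outer_mon (outer v).

(* The composite arrows vA -> vB_k, A_j -> vB and vA -> vB are e, h and h o e,
   whatever the path.  Values at pairs that are not v <= w are irrelevant. *)
Definition D_fun (v w : cube) : D_ob v -> D_ob w :=
  match outer v as o, outer w as o' return outer_mon o -> outer_mon o' with
  | true, true => (if v == w then id else map_h \o map_e) : nat -> nat
  | true, false => map_e
  | false, false => if (v == vA1) && (w == vB2) then map_s else id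
  | false, true => map_h
  end.

Lemma D_fun_nmod v w : GRing.nmod_morphism (@D_fun v w).
Proof.
rewrite /D_fun /D_ob; case: (outer v); case: (outer w); split => //.
- by case: ifP.
- by move=> x y; case: ifP => // _; rewrite /map_h /map_e /= addnACA.
- by move=> [x1 x2] [y1 y2]; rewrite /map_h /= addnACA.
- by case: ifP.
- by move=> x y; case: ifP.
Qed.
HB.instance Definition _ v w :=
  GRing.isNmodMorphism.Build (D_ob v) (D_ob w) (@D_fun v w) (@D_fun_nmod v w).

Lemma D_fun_id v (vv : (v <= v)%O) : @D_fun v v =1 id.
Proof. by move: v {vv} => [[[] []] []]. Qed.

Lemma D_fun_comp u v w (uv : (u <= v)%O) (vw : (v <= w)%O) (uw : (u <= w)%O) :
  @D_fun u w =1 @D_fun v w \o @D_fun u v.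
Proof.
move: u v w uv vw uw => [[[] []] []] [[[] []] []] // [[[] []] []] // _ _ _;
  by case=> [x y] //=; rewrite /D_fun /= /map_h addnC.
Qed.

Definition D : mon_diagram cube :=
  @MonDiagram _ cube D_ob (fun v w _ => @D_fun v w) D_fun_id D_fun_comp.

Lemma D_bottom :
  [/\ @D_fun vA vA0 = map_e, @D_fun vA vA1 = map_e & @D_fun vA vA2 = map_e].
Proof. by []. Qed.

Lemma D_middle :
  [/\ @D_fun vA0 vB2 = id, @D_fun vA0 vB1 = id, @D_fun vA1 vB0 = id,
      @D_fun vA2 vB1 = id & @D_fun vA2 vB0 = id] /\ @D_fun vA1 vB2 = map_s.
Proof. by []. Qed.

Lemma D_top :
  [/\ @D_fun vB0 vB = map_h, @D_fun vB1 vB = map_h & @D_fun vB2 vB = map_h].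
Proof. by []. Qed.

(* Main.v *)
Require Import Defs.
From mathcomp Require Import all_boot all_order all_algebra.

(** Lift the generator of [A] to an idempotent [a].  In each [A_j] the class of
    [a] is (1,0) + (0,1), so [a = x_j + y_j] with [x_j], [y_j] orthogonal
    idempotents of these classes.  In [B_k] the classes (1,0) and (0,1) are
    perpendicular, so by V-semiprimitivity idempotents of these classes are
    orthogonal, which forces two decompositions of the same idempotent to
    coincide.  Hence [x_0 = x_2] in [B_1], [x_1 = x_2] in [B_0], and, because of
    the swap, [x_0 = y_1] in [B_2].  In [B] the orthogonal idempotents [x_1] and
    [y_1] are therefore equal, so [x_1 = 0] there, yet its class is
    [h (1, 0) = 1]. *)

Set Implicit Arguments.
Unset Strict Implicit.
Unset Printing Implicit Defensive.

Import GRing.Theory.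
Local Open Scope ring_scope.

Section Decomposition.
Variable R : rngType.
Implicit Types (a x y : Iinf R) (u v : V R).

Definition orthogonal_sum a x y :=
  [/\ (x : Minf R) ** y = 0, (y : Minf R) ** x = 0
    & (a : Minf R) = (x : Minf R) + y].

Lemma Vclass_split a u v : Vclass a = u + v ->
  exists x y, [/\ orthogonal_sum a x y, Vclass x = u & Vclass y = v].
Proof.
elim/Vclass_ind: u => p; elim/Vclass_ind: v => q.
rewrite VclassD_dsum => /eqP/VclassP[t [s [ats pqst]]].
pose P := spread false (p : Minf R); pose Q := spread true (q : Minf R).
have st : s ** t = P + Q by rewrite -pqst.
have PP : P ** P = P by rewrite spreadM eqxx Iinf_idem.
have QQ : Q ** Q = Q by rewrite spreadM eqxx Iinf_idem.
have PQ : P ** Q = 0 by rewrite spreadM.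
have QP : Q ** P = 0 by rewrite spreadM.
have PS : P ** (P + Q) = P by rewrite rmulDr PP PQ addr0.
have QS : Q ** (P + Q) = Q by rewrite rmulDr QQ QP add0r.
(* [a = t s] and [s t = P + Q], so [E |-> t E s] carries the decomposition of
   [P + Q] over to [a]. *)
have conjM E F : t ** E ** s ** (t ** F ** s) = t ** (E ** (P + Q) ** F) ** s.
  by rewrite -st !rmulA.
have xP : t ** P ** s ** (t ** P ** s) == t ** P ** s by rewrite conjM PS PP.
have yP : t ** Q ** s ** (t ** Q ** s) == t ** Q ** s by rewrite conjM QS QQ.
exists (IdemMx xP), (IdemMx yP); split; first split.
- by rewrite [LHS]conjM PS PQ rmulr0 rmul0r.
- by rewrite [LHS]conjM QS QP rmulr0 rmul0r.
(* [a = a a = t (s t) s = t (P + Q) s]. *)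
- by rewrite [RHS]/= -rmulDl -rmulDr -st -(Iinf_idem a) ats !rmulA.
- rewrite -(Vclass_spread false p).
  (* The product in the other order is [P (s t) P = P (P + Q) P = P]. *)
  apply: (@Vclass_eq _ _ _ (t ** P) (P ** s)).
    by rewrite rmulA -(rmulA t P P) PP.
  by rewrite rmulA -(rmulA P s t) st PS PP.
- rewrite -(Vclass_spread true q).
  apply: (@Vclass_eq _ _ _ (t ** Q) (Q ** s)).
    by rewrite rmulA -(rmulA t Q Q) QQ.
  by rewrite rmulA -(rmulA Q s t) st QS QQ.
Qed.

(** Both sides equal [x x']: [x = x a = x x' + x y'] and [x' = a x' = x x' + y x']. *)
Lemma orthogonal_sum_unique a x y x' y' :
    orthogonal_sum a x y -> orthogonal_sum a x' y' ->
    (x : Minf R) ** y' = 0 -> (y : Minf R) ** x' = 0 ->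
  (x : Minf R) = x'.
Proof.
move=> [xy _ aE] [_ yx' aE'] xy' yx; transitivity ((x : Minf R) ** x').
  transitivity ((x : Minf R) ** a).
    by rewrite aE rmulDr xy addr0 Iinf_idem.
  by rewrite aE' rmulDr xy' addr0.
transitivity ((a : Minf R) ** x'); first by rewrite aE rmulDl yx addr0.
by rewrite aE' rmulDl yx' addr0 Iinf_idem.
Qed.

End Decomposition.

Lemma orthogonal_sum_map (R S : rngType) (f : {rngmorphism R -> S})
    (a x y : Iinf R) :
  orthogonal_sum a x y ->
  orthogonal_sum (Iinf_map f a) (Iinf_map f x) (Iinf_map f y).
Proof.
by case=> xy yx aE; split; rewrite /= -?rng_morphM ?xy ?yx ?aE ?raddf0 ?raddfD.
Qed.

Lemma mon_perp_sym (M : nmodType) (u v : M) : mon_perp u v -> mon_perp v u.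
Proof. by move=> uv n z n0 zv zu; exact: (uv n z n0 zu zv). Qed.

(** A pair below a multiple of (1,0) has second coordinate 0, and one below a multiple of (0,1) has
    first coordinate 0. *)
Lemma mon_perp_pair (M : nmodType) (psi : {additive M -> (nat * nat)%type})
    (u v : M) :
  injective psi -> psi u = (1, 0)%N -> psi v = (0, 1)%N -> mon_perp u v.
Proof.
move=> psi_inj pu pv n z _ [w wE] [w' wE']; apply: psi_inj; rewrite raddf0.
have pairM (p : nat * nat) m : p *+ m = (m * p.1, m * p.2)%N.
  by elim: m => [|m IHm]; rewrite ?mulr0n // mulrS IHm !mulSn.
move/(congr1 psi): wE'; move/(congr1 psi): wE.
rewrite !raddfMn !raddfD pu pv !pairM /= !muln0.
case: (psi z) (psi w) (psi w') => [z1 z2] [w1 w2] [w1' w2'] [_ z2E] [z1E _].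
by move/esym/eqP: z1E; move/esym/eqP: z2E;
  rewrite !addn_eq0 => /andP[/eqP-> _] /andP[/eqP-> _].
Qed.

Section PairClasses.
Variables (S : rngType) (psi : {additive V S -> (nat * nat)%type}).
Implicit Types a x y : Iinf S.

(** Here [psi] stands for the isomorphism given at a middle vertex of the cube. The order of [x] and
    [y] matters: it is what the swap reverses. *)
Definition pair_split a x y :=
  [/\ orthogonal_sum a x y, psi (Vclass x) = (1, 0)%N
    & psi (Vclass y) = (0, 1)%N].

Lemma pair_split_exists a : bijective psi -> psi (Vclass a) = (1, 1)%N ->
  exists x y, pair_split a x y.
Proof.
move=> psi_bij; have [g psiK gK] := psi_bij; move=> pa.
have [x [y [axy xg yg]]] : exists x y,
    [/\ orthogonal_sum a x y, Vclass x = g (1, 0)%N & Vclass y = g (0, 1)%N].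
  by apply: Vclass_split; apply: (bij_inj psi_bij); rewrite raddfD !gK pa.
by exists x, y; split; rewrite // ?xg ?yg gK.
Qed.

(** The classes of [x] and [y'] are perpendicular, and so are those of [y] and [x'];
    V-semiprimitivity makes both products vanish. *)
Lemma pair_split_unique a x y x' y' : injective psi -> V_semiprimitive S ->
  pair_split a x y -> pair_split a x' y' -> x = x'.
Proof.
move=> psi_inj sp [axy px py] [axy' px' py']; apply: val_inj.
apply: (orthogonal_sum_unique axy axy'); apply: sp.
  exact: mon_perp_pair px py'.
by apply: mon_perp_sym; exact: mon_perp_pair px' py.
Qed.

End PairClasses.

Lemma pair_split_map (R S : rngType) (f : {rngmorphism R -> S})
    (rho : {additive V R -> (nat * nat)%type})
    (psi : {additive V S -> (nat * nat)%type}) (a x y : Iinf R) :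
  (forall u, psi (V_map f u) = rho u) ->
  pair_split rho a x y ->
  pair_split psi (Iinf_map f a) (Iinf_map f x) (Iinf_map f y).
Proof.
move=> psif [axy px py]; split; first exact: orthogonal_sum_map.
  by rewrite -V_map_class psif.
by rewrite -V_map_class psif.
Qed.

Lemma pair_split_map_swap (R S : rngType) (f : {rngmorphism R -> S})
    (rho : {additive V R -> (nat * nat)%type})
    (psi : {additive V S -> (nat * nat)%type}) (a x y : Iinf R) :
  (forall u, psi (V_map f u) = map_s (rho u)) ->
  pair_split rho a x y ->
  pair_split psi (Iinf_map f a) (Iinf_map f y) (Iinf_map f x).
Proof.
move=> psif [axy px py]; split.
- have [xy yx aE] := orthogonal_sum_map f axy.
  by split; rewrite // aE addrC.
- by rewrite -V_map_class psif py.
- by rewrite -V_map_class psif px.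
Qed.

Lemma Iinf_map_comp (d : Order.disp_t) (I : porderType d) (R : rng_diagram I)
    i j k (ij : (i <= j)%O) (jk : (j <= k)%O) (ik : (i <= k)%O) (a : Iinf (R i)) :
  Iinf_map (rng_mor R jk) (Iinf_map (rng_mor R ij) a) = Iinf_map (rng_mor R ik) a.
Proof.
by apply: val_inj; apply: MinfP => p q; rewrite /= (rng_mor_comp ij jk ik).
Qed.

Theorem corollary10p2 :
  ~ exists R : rng_diagram cube,
      mon_diagram_iso (V_diagram R) D /\
      V_semiprimitive (R vB0) /\ V_semiprimitive (R vB1) /\ V_semiprimitive (R vB2).
Proof.
case=> R [[phi [phi_bij phi_nat]] [sp0 [sp1 sp2]]].
have phiE v w (vw : (v <= w)%O) u :
  phi w (V_map (rng_mor R vw) u) = @D_fun v w (phi v u) := phi_nat v w vw u.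
have phi_inj v := bij_inj (phi_bij v).
have [a phi_a] : exists a : Iinf (R vA), phi vA (Vclass a) = 1%N.
  have [g _ gK] := phi_bij vA; have := gK 1%N.
  by elim/Vclass_ind: (g 1%N) => a <-; exists a.
have phi_map v (av : (vA <= v)%O) :
    phi v (Vclass (Iinf_map (rng_mor R av) a)) = @D_fun vA v 1%N.
  by rewrite -V_map_class phiE phi_a.
have aA0 : (vA <= vA0)%O by []. have aA1 : (vA <= vA1)%O by [].
have aA2 : (vA <= vA2)%O by []. have aB0 : (vA <= vB0)%O by [].
have aB1 : (vA <= vB1)%O by []. have aB2 : (vA <= vB2)%O by [].
have a0B1 : (vA0 <= vB1)%O by []. have a0B2 : (vA0 <= vB2)%O by [].
have a1B0 : (vA1 <= vB0)%O by []. have a1B2 : (vA1 <= vB2)%O by [].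
have a2B0 : (vA2 <= vB0)%O by []. have a2B1 : (vA2 <= vB1)%O by [].
have b0B : (vB0 <= vB)%O by []. have b1B : (vB1 <= vB)%O by [].
have b2B : (vB2 <= vB)%O by []. have a0B : (vA0 <= vB)%O by [].
have a1B : (vA1 <= vB)%O by []. have a2B : (vA2 <= vB)%O by [].
(* [@D_fun vA vA0 1] computes to (1,1), and likewise at [vA1] and [vA2]. *)
have [x0 [y0 s0]] := pair_split_exists (phi_bij vA0) (phi_map vA0 aA0).
have [x1 [y1 s1]] := pair_split_exists (phi_bij vA1) (phi_map vA1 aA1).
have [x2 [y2 s2]] := pair_split_exists (phi_bij vA2) (phi_map vA2 aA2).
have x12 : Iinf_map (rng_mor R a1B0) x1 = Iinf_map (rng_mor R a2B0) x2.
  have := pair_split_map (phiE _ _ a1B0) s1.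
  have := pair_split_map (phiE _ _ a2B0) s2.
  (* By commutativity both splittings are of the same image of [a]. *)
  rewrite !(Iinf_map_comp _ _ aB0) => s2' s1'.
  exact: pair_split_unique (phi_inj vB0) sp0 s1' s2'.
have x02 : Iinf_map (rng_mor R a0B1) x0 = Iinf_map (rng_mor R a2B1) x2.
  have := pair_split_map (phiE _ _ a0B1) s0.
  have := pair_split_map (phiE _ _ a2B1) s2.
  rewrite !(Iinf_map_comp _ _ aB1) => s2' s0'.
  exact: pair_split_unique (phi_inj vB1) sp1 s0' s2'.
have x0y1 : Iinf_map (rng_mor R a0B2) x0 = Iinf_map (rng_mor R a1B2) y1.
  have := pair_split_map (phiE _ _ a0B2) s0.
  have := pair_split_map_swap (phiE _ _ a1B2) s1.
  rewrite !(Iinf_map_comp _ _ aB2) => s1' s0'.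
  exact: pair_split_unique (phi_inj vB2) sp2 s0' s1'.
have x1y1 : Iinf_map (rng_mor R a1B) x1 = Iinf_map (rng_mor R a1B) y1.
  (* In [R vB], [x1 = x2] through [vB0], [x2 = x0] through [vB1], and [x0 = y1] through [vB2]. *)
  rewrite -(Iinf_map_comp a1B0 b0B a1B) x12 (Iinf_map_comp a2B0 b0B a2B).
  rewrite -(Iinf_map_comp a2B1 b1B a2B) -x02 (Iinf_map_comp a0B1 b1B a0B).
  by rewrite -(Iinf_map_comp a0B2 b2B a0B) x0y1 (Iinf_map_comp a1B2 b2B a1B).
have [axy1 px1 _] := s1; have [xy1 _ _] := orthogonal_sum_map (rng_mor R a1B) axy1.
have x1_0 : Iinf_map (rng_mor R a1B) x1 = Iinf0 (R vB).
  (* With images in [R vB], [x1 = x1 x1 = x1 y1 = 0]. *)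
  by apply: val_inj; rewrite -[LHS]Iinf_idem {2}x1y1.
(* Naturality now reads [0 = map_h (1, 0) = 1]. *)
have := phiE _ _ a1B (Vclass x1).
by rewrite px1 V_map_class x1_0 Vclass0 raddf0.
Qed.
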